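(* Let ${\bf K}=\tau I_{NJ}+\eta GG^{\rm T}$ with $G=2B\otimes I_J+\tau I_N\otimes L_h$, and for $\alpha>0$ let ${\bf P}_{\alpha}={\bf R}_{\alpha}{\bf R}_{\alpha}^{\rm T}$ with ${\bf R}_{\alpha}=(\sqrt{\tau}I_N+2\sqrt{\eta}B_{\alpha})\otimes I_J+\tau\sqrt{\eta}\,I_N\otimes L_h$ and $B_\alpha=B+\alpha\tilde B$. For any $$\alpha\in\left(0,\min\left\{\frac{\tau}{24\sqrt{\gamma}},\frac{\tau^{3/2}}{2\sqrt{6\gamma}\,T},\frac{\tau^{2}}{8\sqrt{3\gamma}\,T},\frac13\right\}\right],$$ it holds that $\sigma({\bf P}_{\alpha}^{-1}{\bf K})\subset\left[\frac38,\frac32\right]$.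
   Context: Setting: $N,J\ge 1$ are integers, $T>0$ and $\gamma>0$ are real numbers, $\tau=T/N$, and $\eta=\gamma/\tau$. $I_k$ is the $k\times k$ identity matrix, $\otimes$ is the Kronecker product, and $\sigma(\cdot)$ denotes the spectrum of a square matrix. $L_h\in\mathbb{R}^{J\times J}$ is a real symmetric positive semi-definite matrix (a central difference discretization of $-\nabla\cdot(a(x)\nabla)$ with $a\ge 0$). Set $q_0=1$ and $q_k=2(-1)^k$ for $k\ge 1$. $B\in\mathbb{R}^{N\times N}$ is the lower triangular Toeplitz matrix with $B(i,j)=q_{i-j}$ for $i\ge j$ and $B(i,j)=0$ for $i<j$. $\tilde B\in\mathbb{R}^{N\times N}$ is the strictly upper triangular Toeplitz matrix with $\tilde B(i,j)=q_{N-(j-i)}$ for $j>i$ and $\tilde B(i,j)=0$ for $j\le i$ (so its first row is $(0,q_{N-1},\ldots,q_1)$). For $\alpha$ in the stated range, ${\bf P}_\alpha$ is invertible, so ${\bf P}_\alpha^{-1}$ makes sense. *)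

(* Defs.v *)
From mathcomp Require Import all_boot all_order all_algebra.
From mathcomp Require Import classical_sets set_interval reals.
From mathcomp Require Import mxtens.
From mathcomp.real_closed Require Import complex.

Set Implicit Arguments.
Unset Strict Implicit.
Unset Printing Implicit Defensive.

Import Order.TTheory GRing.Theory Num.Theory.
Local Open Scope ring_scope.
Local Open Scope complex_scope.

Definition psdmx (R : realType) (n : nat) (A : 'M[R]_n) : Prop :=
  A^T = A /\ forall x : 'cV[R]_n, 0 <= (x^T *m A *m x) 0 0.

(* All complex eigenvalues of a real matrix, so that an inclusion of the
   spectrum in a real interval also says that the eigenvalues are real. *)
Definition spectrum (R : realType) (n : nat) (A : 'M[R]_n) : set R[i] :=
  [set z : R[i] | eigenvalue (map_mx (real_complex R) A) z].

Definition qcoef (R : realType) (k : nat) : R :=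
  if k == 0%N then 1 else 2 * (-1) ^+ k.

(* Indices start at 0; the entries only depend on differences of indices. *)
Definition Bmx (R : realType) (N : nat) : 'M[R]_N :=
  \matrix_(i < N, j < N) if (j <= i)%N then qcoef R (i - j) else 0.

Definition Btilde (R : realType) (N : nat) : 'M[R]_N :=
  \matrix_(i < N, j < N) if (i < j)%N then qcoef R (N - (j - i)) else 0.

Definition Balpha (R : realType) (N : nat) (alpha : R) : 'M[R]_N :=
  Bmx R N + alpha *: Btilde R N.

Definition Gmx (R : realType) (N J : nat) (tau : R) (L : 'M[R]_J) :
    'M[R]_(N * J) :=
  (2 *: Bmx R N) *t (1%:M : 'M[R]_J) + tau *: ((1%:M : 'M[R]_N) *t L).

Definition Kmx (R : realType) (N J : nat) (tau eta : R) (L : 'M[R]_J) :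
    'M[R]_(N * J) :=
  tau *: 1%:M + eta *: (Gmx N tau L *m (Gmx N tau L)^T).

Definition Rmx (R : realType) (N J : nat) (tau eta : R) (L : 'M[R]_J)
    (alpha : R) : 'M[R]_(N * J) :=
  (Num.sqrt tau *: 1%:M + (2 * Num.sqrt eta) *: Balpha N alpha)
      *t (1%:M : 'M[R]_J)
  + (tau * Num.sqrt eta) *: ((1%:M : 'M[R]_N) *t L).

Definition Pmx (R : realType) (N J : nat) (tau eta : R) (L : 'M[R]_J)
    (alpha : R) : 'M[R]_(N * J) :=
  Rmx N tau eta L alpha *m (Rmx N tau eta L alpha)^T.

(* tau^(3/2) is written (sqrt tau)^3. *)
Definition alpha_max (R : realType) (T gamma tau : R) : R :=
  Num.min (tau / (24 * Num.sqrt gamma))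
  (Num.min (Num.sqrt tau ^+ 3 / (2 * Num.sqrt (6 * gamma) * T))
  (Num.min (tau ^+ 2 / (8 * Num.sqrt (3 * gamma) * T))
           (1 / 3))).

(* Main.v *)
(** Everything is a comparison of quadratic forms: an eigenvalue of [P^-1 K] is
a generalized Rayleigh quotient of two real symmetric forms, so it suffices that
[3/8 P <= K <= 3/2 P] with [P] positive definite. Writing [M = G + E] with
[E = 2 alpha Btilde (x) I], one has [R_alpha = sqrt tau I + sqrt eta M]. With
[s = ((-1)^i)_i], [B + B^T = 2 s s^T] and
[Btilde + Btilde^T = 2 (-1)^N (s s^T - I)], so the symmetric part of [M] is at
least [-2 alpha], and the cross term of [|w R_alpha|^2] costs at most a sixth of
[tau |w|^2]. The entries of [Btilde] are bounded by 2, hence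
[eta |w E|^2 <= tau/12 |w|^2], which lets one exchange [M] and [G]. *)

Require Import Defs.
From mathcomp Require Import all_boot all_order all_algebra.
From mathcomp Require Import classical_sets set_interval reals.
From mathcomp Require Import mxtens.
From mathcomp.real_closed Require Import complex.
From mathcomp Require Import ring lra.

Set Implicit Arguments.
Unset Strict Implicit.
Unset Printing Implicit Defensive.

Import Order.TTheory GRing.Theory Num.Theory.
Local Open Scope classical_set_scope.
Local Open Scope ring_scope.

(** * Inner products of row vectors; rows, because eigenvectors multiply from the left *)

Definition dot {R : realFieldType} {n : nat} (x y : 'rV[R]_n) : R :=
  (x *m y^T) 0 0.

Section Dot.
Variables (R : realFieldType) (n : nat).
Implicit Types x y z : 'rV[R]_n.

Lemma dotE x y : dot x y = \sum_i x 0 i * y 0 i.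
Proof. by rewrite /dot mxE; apply: eq_bigr => i _; rewrite mxE. Qed.

Lemma dotC x y : dot x y = dot y x.
Proof. by rewrite !dotE; apply: eq_bigr => i _; rewrite mulrC. Qed.

Lemma dotDl x y z : dot (x + y) z = dot x z + dot y z.
Proof. by rewrite /dot mulmxDl mxE. Qed.

Lemma dotZl a x z : dot (a *: x) z = a * dot x z.
Proof. by rewrite /dot -scalemxAl mxE. Qed.

Lemma dotDr x y z : dot z (x + y) = dot z x + dot z y.
Proof. by rewrite dotC dotDl !(dotC z). Qed.

Lemma dotZr a x z : dot z (a *: x) = a * dot z x.
Proof. by rewrite dotC dotZl (dotC z). Qed.

Lemma dot_ge0 x : 0 <= dot x x.
Proof. by rewrite dotE sumr_ge0 // => i _; rewrite -expr2 sqr_ge0. Qed.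

Lemma dot_gt0 x : x != 0 -> 0 < dot x x.
Proof.
move=> x0; rewrite lt_neqAle dot_ge0 andbT eq_sym; apply: contra x0.
rewrite dotE psumr_eq0 => [/allP h|i _]; last by rewrite -expr2 sqr_ge0.
apply/eqP/rowP => i; rewrite mxE; apply/eqP.
by have := h i (mem_index_enum _); rewrite -expr2 sqrf_eq0.
Qed.

Lemma dot_mulmxl x y (A : 'M[R]_n) : dot (x *m A) y = dot x (y *m A^T).
Proof. by rewrite /dot trmx_mul trmxK mulmxA. Qed.

Lemma form_sym x (A : 'M[R]_n) :
  2 * dot x (x *m A) = dot x (x *m (A + A^T)).
Proof. by rewrite mulmxDr dotDr -dot_mulmxl (dotC (_ *m _)); ring. Qed.

Lemma dot_lincomb a x y :
  dot (x + a *: y) (x + a *: y) = dot x x + 2 * a * dot x y + a ^+ 2 * dot y y.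
Proof. by rewrite !(dotDl, dotDr, dotZl, dotZr) (dotC y x); ring. Qed.

Lemma Cauchy_Schwarz x y : dot x y ^+ 2 <= dot x x * dot y y.
Proof.
have [->|x0] := eqVneq x 0.
  by rewrite /dot !mul0mx mxE expr2 !mul0r.
have xx := dot_gt0 x0.
(* The squared norm of this vector is [dot x x] times the gap between the two sides. *)
have := dot_ge0 (dot x x *: y + (- dot x y) *: x).
rewrite dot_lincomb !(dotZl, dotZr) (dotC y x) => h.
rewrite -subr_ge0 -(pmulr_rge0 _ xx).
by apply: (le_trans h); rewrite le_eqVlt; apply/orP; left; apply/eqP; ring.
Qed.

End Dot.

(** A Frobenius-type bound: Cauchy-Schwarz against each column, of squared norm at most [n c], gives
    one factor [n], and summing over the [n] columns gives the other. *)
Lemma dot_mulmx_entry_bound (R : realFieldType) (n : nat) (A : 'M[R]_n)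
    (c : R) (x : 'rV[R]_n) :
  (forall i j, A i j ^+ 2 <= c) ->
  dot (x *m A) (x *m A) <= n%:R ^+ 2 * c * dot x x.
Proof.
move=> Ac.
have xAj j : (x *m A) 0 j ^+ 2 <= n%:R * c * dot x x.
  have -> : (x *m A) 0 j = dot x (col j A)^T.
    by rewrite dotE mxE; apply: eq_bigr => i _; rewrite !mxE.
  apply: (le_trans (Cauchy_Schwarz _ _)); rewrite mulrC ler_wpM2r ?dot_ge0 // dotE.
  rewrite mulr_natl -[n in _ *+ n]card_ord -sumr_const; apply: ler_sum => i _.
  by rewrite !mxE -expr2.
rewrite dotE (le_trans (ler_sum _ (G := fun=> n%:R * c * dot x x) _)) //.
  by move=> j _; rewrite -expr2.
by rewrite sumr_const card_ord -[leLHS]mulr_natl expr2 !mulrA.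
Qed.

(** * Kronecker products acting on slices *)

Section TensorSlices.
Variables (R : realFieldType) (N J : nat).
Implicit Type w : 'rV[R]_(N * J).

(** With [w] read as an [N] by [J] array, these are its columns and rows. [A *t 1%:M] acts on each
    column separately and [1%:M *t C] on each row, so bounds on forms pass to the products by
    summing over slices. *)
Definition lslice (l : 'I_J) w : 'rV[R]_N := \row_i w 0 (mxtens_index (i, l)).
Definition rslice (i : 'I_N) w : 'rV[R]_J := \row_l w 0 (mxtens_index (i, l)).

Lemma sum_mxtens_index (F : 'I_(N * J) -> R) :
  \sum_k F k = \sum_i \sum_l F (mxtens_index (i, l)).
Proof.
rewrite pair_big; apply: reindex.
exists (@mxtens_unindex N J) => k _; rewrite -?surjective_pairing.
  by rewrite mxtens_indexK; case: k.
by rewrite mxtens_unindexK.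
Qed.

Lemma dot_rslice w w' : dot w w' = \sum_i dot (rslice i w) (rslice i w').
Proof.
rewrite dotE sum_mxtens_index; apply: eq_bigr => i _; rewrite dotE.
by apply: eq_bigr => l _; rewrite !mxE.
Qed.

Lemma dot_lslice w w' : dot w w' = \sum_l dot (lslice l w) (lslice l w').
Proof.
rewrite dotE sum_mxtens_index exchange_big; apply: eq_bigr => l _; rewrite dotE.
by apply: eq_bigr => i _; rewrite !mxE.
Qed.

Lemma lslice_tens w (A : 'M[R]_N) l :
  lslice l (w *m (A *t 1%:M)) = lslice l w *m A.
Proof.
apply/rowP => j; rewrite !mxE sum_mxtens_index; apply: eq_bigr => i _.
rewrite (bigD1 l) //= tensmxE !mxE eqxx mulr1 big1 ?addr0 // => k kl.
by rewrite tensmxE !mxE (negPf kl) !mulr0.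
Qed.

Lemma rslice_tens w (C : 'M[R]_J) i :
  rslice i (w *m (1%:M *t C)) = rslice i w *m C.
Proof.
apply/rowP => j; rewrite !mxE sum_mxtens_index exchange_big.
apply: eq_bigr => l _.
rewrite (bigD1 i) //= tensmxE !mxE eqxx mul1r big1 ?addr0 // => k kl.
by rewrite tensmxE !mxE (negPf kl) mul0r mulr0.
Qed.

Lemma tens1 : (1%:M : 'M[R]_(N * J)) = 1%:M *t 1%:M.
Proof.
apply/matrixP => i j.
case: (mxtens_indexP i) => i1 i2; case: (mxtens_indexP j) => j1 j2.
rewrite tensmxE !mxE (inj_eq (can_inj (@mxtens_indexK N J))) xpair_eqE.
by rewrite -natrM mulnb.
Qed.

Lemma form_tensl_ge (A : 'M[R]_N) (c : R) w :
  (forall x, c * dot x x <= dot x (x *m A)) ->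
  c * dot w w <= dot w (w *m (A *t 1%:M)).
Proof.
move=> Ac; rewrite !dot_lslice mulr_sumr; apply: ler_sum => l _.
by rewrite lslice_tens.
Qed.

Lemma form_tensr_ge0 (C : 'M[R]_J) w :
  (forall x, 0 <= dot x (x *m C)) -> 0 <= dot w (w *m (1%:M *t C)).
Proof.
by move=> C0; rewrite dot_rslice sumr_ge0 // => i _; rewrite rslice_tens.
Qed.

Lemma norm_tensl_le (A : 'M[R]_N) (c : R) w :
  (forall x, dot (x *m A) (x *m A) <= c * dot x x) ->
  dot (w *m (A *t 1%:M)) (w *m (A *t 1%:M)) <= c * dot w w.
Proof.
move=> Ac; rewrite !dot_lslice mulr_sumr; apply: ler_sum => l _.
by rewrite lslice_tens.
Qed.

End TensorSlices.

(** * Eigenvalues of a symmetric definite pencil *)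

(** A complex eigenvector is split into real and imaginary parts [a] and [b]. Symmetry makes the
    eigenvalue real, and it is then the quotient of the [K]-form by the [P]-form, each summed over
    [a] and [b]. *)
Lemma spectrum_pencil (R : realType) (n : nat) (P K : 'M[R]_n) (c d : R) :
  P^T = P -> K^T = K ->
  (forall w, w != 0 -> 0 < dot w (w *m P)) ->
  (forall w, c * dot w (w *m P) <= dot w (w *m K) <= d * dot w (w *m P)) ->
  P \in unitmx /\
  spectrum (invmx P *m K) `<=` real_complex R @` `[c, d].
Proof.
move=> Psym Ksym Ppos PK.
have Pu : P \in unitmx.
  rewrite -row_free_unit; apply: inj_row_free => v vP0.
  apply/eqP; apply: contraT => /Ppos.
  by rewrite vP0 /dot trmx0 mulmx0 mxE ltxx.
split => // -[x y] /eigenvalueP [v vPK v0].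
(* This substitution removes the inverse: [w K = z w P] for the eigenvalue [z]. *)
pose w := v *m invmx (map_mx (real_complex R) P).
have cPu : map_mx (real_complex R) P \in unitmx by rewrite map_unitmx.
have wP : w *m map_mx (real_complex R) P = v by rewrite mulmxKV.
have wK : w *m map_mx (real_complex R) K =
    (x +i* y)%C *: (w *m map_mx (real_complex R) P).
  by rewrite wP -vPK map_mxM map_invmx mulmxA.
have w0 : w != 0 by apply: contraNneq v0 => w0; rewrite -wP w0 mul0mx.
clearbody w.
pose a := map_mx (@complex.Re R) w; pose b := map_mx (@complex.Im R) w.
have reM (A : 'M[R]_n) i :
    complex.Re ((w *m map_mx (real_complex R) A) 0 i) = (a *m A) 0 i.
  rewrite !mxE (raddf_sum (@complex.Re R : Rcomplex R -> R)).
  apply: eq_bigr => j _; rewrite !mxE; case: (w 0 j) => p q /=.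
  by rewrite mulr0 subr0.
have imM (A : 'M[R]_n) i :
    complex.Im ((w *m map_mx (real_complex R) A) 0 i) = (b *m A) 0 i.
  rewrite !mxE (raddf_sum (@complex.Im R : Rcomplex R -> R)).
  apply: eq_bigr => j _; rewrite !mxE; case: (w 0 j) => p q /=.
  by rewrite mulr0 add0r.
have scaleE (u v' : 'rV[R]_n) p q i :
    (p *: u + q *: v') 0 i = p * u 0 i + q * v' 0 i by rewrite !mxE.
have wKi i : (w *m map_mx (real_complex R) K) 0 i =
    (x +i* y)%C * (w *m map_mx (real_complex R) P) 0 i by rewrite wK mxE.
have aK : a *m K = x *: (a *m P) + (- y) *: (b *m P).
  apply/rowP => i; rewrite scaleE -!reM -imM wKi.
  by case: (_ 0 i) => p q /=; rewrite mulNr.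
have bK : b *m K = x *: (b *m P) + y *: (a *m P).
  apply/rowP => i; rewrite scaleE -!imM -reM wKi.
  by case: (_ 0 i).
have ab0 : (a != 0) || (b != 0).
  rewrite -negb_and; apply: contra w0 => /andP[/eqP a0 /eqP b0].
  apply/eqP/rowP => i; rewrite mxE.
  have : a 0 i = 0 by rewrite a0 mxE.
  have : b 0 i = 0 by rewrite b0 mxE.
  by rewrite !mxE; case: (w 0 i) => p q /= -> ->.
have Pge0 u : 0 <= dot u (u *m P).
  have [->|/Ppos/ltW//] := eqVneq u 0.
  by rewrite /dot mul0mx mxE.
have Pab : 0 < dot a (a *m P) + dot b (b *m P).
  case/orP: ab0 => /Ppos h; first by rewrite ltr_wpDr.
  by rewrite ltr_wpDl.
have Psw : dot a (b *m P) = dot b (a *m P) by rewrite dotC dot_mulmxl Psym.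
have Ksw : dot a (b *m K) = dot b (a *m K) by rewrite dotC dot_mulmxl Ksym.
(* In [dot a (b *m K) = dot b (a *m K)] the terms in [x] cancel, leaving [y] times the positive sum
   [Pab] equal to 0. *)
have y0 : y = 0.
  move: Ksw; rewrite aK bK !dotDr !dotZr Psw => h.
  apply/eqP; rewrite -(mulIr_eq0 _ (mulIf (lt0r_neq0 Pab))); apply/eqP; lra.
have quot : dot a (a *m K) + dot b (b *m K) =
    x * (dot a (a *m P) + dot b (b *m P)).
  by rewrite aK bK !dotDr !dotZr Psw; ring.
exists x; last by rewrite y0.
have /andP[a1 a2] := PK a; have /andP[b1 b2] := PK b.
rewrite /= in_itv /=; apply/andP; split.
  by rewrite -(ler_pM2r Pab) -quot mulrDr lerD.
by rewrite -(ler_pM2r Pab) -quot mulrDr lerD.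
Qed.

(** * Symmetric parts of the Toeplitz matrices *)

Definition altrow (R : pzRingType) (N : nat) : 'rV[R]_N :=
  \row_(i < N) (-1) ^+ i.

(** The sign splits into a row factor and a column factor; this is the source of the rank-one
    structure. *)
Lemma qcoef_subn (R : realType) (i j : nat) :
  (j < i)%N -> qcoef R (i - j) = 2 * ((-1) ^+ i * (-1) ^+ j).
Proof.
move=> ji; rewrite /qcoef subn_eq0 leqNgt ji /=.
by rewrite -signr_odd oddB ?(ltnW ji) // signr_addb !signr_odd.
Qed.

(** The value [q_0 = 1], half the modulus of the other coefficients, makes the doubled diagonal fit
    the rank-one pattern. *)
Lemma Bmx_sym (R : realType) (N : nat) :
  Bmx R N + (Bmx R N)^T = 2 *: ((altrow R N)^T *m altrow R N).
Proof.
apply/matrixP => i j; rewrite !mxE big_ord1 !mxE.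
case: ltngtP => [ij|ji|/val_inj ->] /=.
- by rewrite addr0 qcoef_subn.
- by rewrite add0r qcoef_subn // [X in 2 * X]mulrC.
- by rewrite subnn /qcoef /= -expr2 sqrr_sign; ring.
Qed.

Lemma Btilde_entry (R : realType) (N : nat) (i j : 'I_N) :
  Btilde R N i j = if (i < j)%N then 2 * (-1) ^+ N * ((-1) ^+ i * (-1) ^+ j)
                   else 0.
Proof.
rewrite mxE; case: ifP => // ij.
(* The index [N - (j - i)] is thus positive, so the exceptional coefficient [q_0] does not occur. *)
have jN : (j - i < N)%N by rewrite (leq_ltn_trans (leq_subr _ _)).
rewrite qcoef_subn // -mulrA; do 2!congr (_ * _).
by rewrite -signr_odd oddB ?(ltnW ij) // signr_addb !signr_odd mulrC.
Qed.

(** The identity is subtracted because [Btilde] has zero diagonal. *)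
Lemma Btilde_sym (R : realType) (N : nat) :
  Btilde R N + (Btilde R N)^T =
  (2 * (-1) ^+ N) *: ((altrow R N)^T *m altrow R N - 1%:M).
Proof.
apply/matrixP => i j; rewrite mxE [X in _ + X]mxE !Btilde_entry.
rewrite !mxE big_ord1 !mxE -val_eqE.
case: ltngtP => ij; rewrite ?subr0 ?addr0 ?add0r //.
- by rewrite [X in 2 * _ * X]mulrC.
- by rewrite ij -expr2 sqrr_sign subrr mulr0.
Qed.

Lemma Btilde_sqr_le (R : realType) (N : nat) (i j : 'I_N) :
  Btilde R N i j ^+ 2 <= 4.
Proof.
rewrite Btilde_entry; case: ifP => _; last by rewrite expr2 mul0r ler0n.
by rewrite !exprMn !sqrr_sign !mulr1 -natrX.
Qed.

(** With [e = (-1)^N], the symmetric part is [(1 + alpha e) s^T s - alpha e I] for the row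
    [s = altrow R N]. Its first term is nonnegative since [alpha <= 1], and the second costs at most
    [alpha]. *)
Lemma Balpha_form_ge (R : realType) (N : nat) (alpha : R) (x : 'rV[R]_N) :
  0 <= alpha <= 1 -> - alpha * dot x x <= dot x (x *m Balpha N alpha).
Proof.
move=> /andP[a0 a1].
set e : R := (-1) ^+ N.
have e1 : -1 <= e <= 1 by rewrite /e -signr_odd; case: odd => /=; lra.
have sym : 2 * dot x (x *m Balpha N alpha) = 2 * (1 + alpha * e) *
    dot x (altrow R N) ^+ 2 - 2 * (alpha * e) * dot x x.
  rewrite form_sym.
  have -> : Balpha N alpha + (Balpha N alpha)^T =
      (2 * (1 + alpha * e)) *: ((altrow R N)^T *m altrow R N)
      + (- (2 * (alpha * e))) *: 1%:M.
    rewrite /Balpha linearD linearZ /= addrACA -scalerDr Bmx_sym Btilde_sym -/e.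
    move: (_ *m altrow R N) => S; apply/matrixP => i j.
    by rewrite !mxE; ring.
  rewrite mulmxDr -!scalemxAr mulmx1 dotDr !dotZr mulmxA.
  have -> : x *m (altrow R N)^T *m altrow R N = dot x (altrow R N) *: altrow R N.
    by rewrite [x *m _]mx11_scalar mul_scalar_mx.
  by rewrite dotZr; ring.
have ae : - alpha <= alpha * e <= alpha by move: e1 => /andP[]; nra.
have := sqr_ge0 (dot x (altrow R N)); have := dot_ge0 x.
move: ae sym => /andP[]; nra.
Qed.

(** * Abstract comparison of the two forms *)

Section Comparison.
Variables (R : realType) (n : nat).
Variables (t h tau eta eps : R) (G E : 'M[R]_n).
Hypotheses (t_ge0 : 0 <= t) (h_ge0 : 0 <= h).
Hypotheses (tauE : tau = t ^+ 2) (etaE : eta = h ^+ 2) (tau_gt0 : 0 < tau).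
Hypothesis skew : forall w, - eps * dot w w <= dot w (w *m (G + E)).
Hypothesis eps_small : 2 * (t * h) * eps <= tau / 6.
Hypothesis E_small :
  forall w, eta * dot (w *m E) (w *m E) <= tau / 12 * dot w w.

Let K := tau *: 1%:M + eta *: (G *m G^T).
Let P := (t *: 1%:M + h *: (G + E)) *m (t *: 1%:M + h *: (G + E))^T.

Lemma form_K w : dot w (w *m K) = tau * dot w w + eta * dot (w *m G) (w *m G).
Proof.
rewrite mulmxDr -!scalemxAr mulmx1 dotDr !dotZr mulmxA.
by rewrite [X in eta * X]dot_mulmxl.
Qed.

Lemma form_P w : dot w (w *m P) = tau * dot w w +
  2 * (t * h) * dot w (w *m (G + E)) + eta * dot (w *m (G + E)) (w *m (G + E)).
Proof.
rewrite /P mulmxA -dot_mulmxl mulmxDr -!scalemxAr mulmx1 dot_lincomb.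
by rewrite !(dotZl, dotZr) tauE etaE; ring.
Qed.

(** By [skew] and [eps_small] the cross term is at least [- tau / 6 * dot w w]. *)
Lemma form_P_ge w : 5 / 6 * tau * dot w w +
  eta * dot (w *m (G + E)) (w *m (G + E)) <= dot w (w *m P).
Proof.
rewrite form_P.
have th : 0 <= 2 * (t * h) by rewrite !mulr_ge0.
have := ler_wpM2l th (skew w); have := ler_wpM2r (dot_ge0 w) eps_small.
lra.
Qed.

(** The cross term is absorbed using that [t w - h w (G + E)] has nonnegative squared norm. *)
Lemma form_P_le w : dot w (w *m P) <=
  2 * (tau * dot w w + eta * dot (w *m (G + E)) (w *m (G + E))).
Proof.
rewrite form_P.
have := dot_ge0 (t *: w + (- h) *: (w *m (G + E))).
rewrite dot_lincomb !(dotZl, dotZr) tauE etaE; lra.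
Qed.

Lemma form_compare w :
  3 / 8 * dot w (w *m P) <= dot w (w *m K) <= 3 / 2 * dot w (w *m P).
Proof.
have eta0 : 0 <= eta by rewrite etaE sqr_ge0.
have := form_P_ge w; have := form_P_le w; rewrite form_K mulmxDr.
have := E_small w; set X := w *m G; set Y := w *m E.
have -> : X + Y = X + 1 *: Y by rewrite scale1r.
rewrite dot_lincomb.
(* The weight 3 gives [2/3 |X|^2 - 2 |Y|^2 <= |X + Y|^2 <= 4/3 |X|^2 + 4 |Y|^2]. With
   [eta |Y|^2 <= tau/12 |w|^2], the coefficients of [tau |w|^2] and [eta |X|^2] then agree:
   [P >= 2/3 K] from [5/6 - 1/6], and [P <= 8/3 K] from [2 (1 + 1/3)]. *)
have := mulr_ge0 eta0 (dot_ge0 (X + 3 *: Y)); rewrite dot_lincomb.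
have := mulr_ge0 eta0 (dot_ge0 (X + (-3) *: Y)); rewrite dot_lincomb.
have := mulr_ge0 (ltW tau_gt0) (dot_ge0 w).
move=> h0 h1 h2 h3 h4 h5; apply/andP; split; lra.
Qed.

Lemma form_P_gt0 w : w != 0 -> 0 < dot w (w *m P).
Proof.
move=> /dot_gt0 w0; apply: lt_le_trans (form_P_ge w).
apply: ltr_wpDr; first by rewrite etaE mulr_ge0 ?sqr_ge0 ?dot_ge0.
by rewrite !mulr_gt0 ?invr_gt0 ?ltr0n.
Qed.

Lemma comparison_spectrum :
  P \in unitmx /\ spectrum (invmx P *m K) `<=` real_complex R @` `[3 / 8, 3 / 2].
Proof.
apply: spectrum_pencil; [| |exact: form_P_gt0|exact: form_compare].
  by rewrite trmx_mul trmxK.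
by rewrite linearD !linearZ /= trmx1 trmx_mul trmxK.
Qed.

End Comparison.

(** * Application to the discretized problem *)

Theorem theorem5 (R : realType) (N J : nat) (hN : (0 < N)%N) (hJ : (0 < J)%N)
    (T gamma : R) (hT : 0 < T) (hgamma : 0 < gamma)
    (L : 'M[R]_J) (hL : psdmx L) :
  let tau := T / N%:R in
  let eta := gamma / tau in
  forall alpha : R, alpha \in `]0, alpha_max T gamma tau] ->
    let K := Kmx N tau eta L in
    let P := Pmx N tau eta L alpha in
    P \in unitmx /\
    spectrum (invmx P *m K) `<=` real_complex R @` `[3 / 8, 3 / 2].
Proof.
move=> tau eta alpha; rewrite in_itv /= /alpha_max !le_min.
move=> /andP[a0 /and4P[a1 _ a3 a4]].
have NR : 0 < N%:R :> R by rewrite ltr0n.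
have tau0 : 0 < tau by rewrite divr_gt0.
have eta0 : 0 < eta by rewrite divr_gt0.
set t := Num.sqrt tau; set h := Num.sqrt eta.
have t2 : tau = t ^+ 2 by rewrite sqr_sqrtr // ltW.
have h2 : eta = h ^+ 2 by rewrite sqr_sqrtr // ltW.
(* Since [tau * eta = gamma], the cross-term coefficient does not depend on [tau]. *)
have th : t * h = Num.sqrt gamma.
  by rewrite -sqrtrM ?ltW // /eta mulrC divfK // gt_eqF.
pose G := Gmx N tau L.
pose E : 'M[R]_(N * J) := (2 * alpha) *: (Btilde R N *t 1%:M).
have GE : G + E = 2 *: (Balpha N alpha *t 1%:M) + tau *: (1%:M *t L).
  by apply/matrixP => i j; rewrite !mxE; ring.
have RE : Rmx N tau eta L alpha = t *: 1%:M + h *: (G + E).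
  rewrite GE /Rmx -/t -/h tens1; apply/matrixP => i j; rewrite !mxE; ring.
rewrite /Pmx RE /Kmx -/G.
apply: (@comparison_spectrum R _ t h tau eta (2 * alpha)) => //.
- exact: sqrtr_ge0.
- exact: sqrtr_ge0.
- move=> w; rewrite GE mulmxDr -!scalemxAr dotDr !dotZr.
  have L0 : 0 <= dot w (w *m (1%:M *t L)).
    apply: form_tensr_ge0 => x; have := hL.2 x^T.
    by rewrite trmxK dotC.
  have B0 : - alpha * dot w w <= dot w (w *m (Balpha N alpha *t 1%:M)).
    by apply: form_tensl_ge => x; apply: Balpha_form_ge; lra.
  by have := mulr_ge0 (ltW tau0) L0; lra.
(* The 24 in the first bound on [alpha] gives [4 alpha sqrt gamma <= tau / 6]. *)
- have s0 : 0 < Num.sqrt gamma by rewrite sqrtr_gt0.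
  rewrite th; move: a1; rewrite ler_pdivlMr ?mulr_gt0 ?ltr0n //; lra.
- move=> w; rewrite -scalemxAr dotZl dotZr.
  have B4 : dot (w *m (Btilde R N *t 1%:M)) (w *m (Btilde R N *t 1%:M)) <=
      N%:R ^+ 2 * 4 * dot w w.
    apply: norm_tensl_le => x.
    by apply: dot_mulmx_entry_bound; exact: Btilde_sqr_le.
  have g0 : 0 < 8 * Num.sqrt (3 * gamma) * T.
    by rewrite !mulr_gt0 ?sqrtr_gt0 ?mulr_gt0 ?ltr0n.
  have a2 : alpha ^+ 2 * (192 * gamma * T ^+ 2) <= tau ^+ 4.
    move: a3; rewrite ler_pdivlMr // => a3.
    have : (alpha * (8 * Num.sqrt (3 * gamma) * T)) ^+ 2 <= (tau ^+ 2) ^+ 2.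
      by rewrite lerXn2r // nnegrE ?sqr_ge0 //; apply: ltW; rewrite mulr_gt0.
    have s2 : Num.sqrt (3 * gamma) ^+ 2 = 3 * gamma.
      by rewrite sqr_sqrtr // ltW // mulr_gt0 ?ltr0n.
    rewrite exprMn (exprMn _ _ T) (exprMn _ 8) s2 -exprM; lra.
  (* The 16 is the 4 of [B4] times the 4 from [(2 * alpha)^2]. Multiplying by [tau^3] and using
     [eta tau = gamma] and [N tau = T] reduces the claim to [a2], where [192 = 16 * 12]. *)
  have key : 16 * eta * alpha ^+ 2 * N%:R ^+ 2 <= tau / 12.
    rewrite -(ler_pM2r (exprn_gt0 3 tau0)).
    have -> : 16 * eta * alpha ^+ 2 * N%:R ^+ 2 * tau ^+ 3 =
        16 * gamma * alpha ^+ 2 * T ^+ 2.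
      rewrite /eta /tau; field.
      by rewrite !gt_eqF.
    have -> : tau / 12 * tau ^+ 3 = tau ^+ 4 / 12 by ring.
    lra.
  apply: le_trans (ler_wpM2r (dot_ge0 w) key).
  have := ler_wpM2l (mulr_ge0 (ltW eta0) (sqr_ge0 (2 * alpha))) B4; lra.
Qed.
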